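(* Let $\mathbb{S}^2\subset\mathbb{R}^3$ be the unit sphere with its induced Euclidean metric, let $N=(0,0,1)$ and $S=(0,0,-1)$, and let $M=\mathbb{S}^2\setminus\{N,S\}$. Let $\vec v$ be a smooth unit vector field defined on $M$. If $k=\max\{I_{\vec v}(N),I_{\vec v}(S)\}$, then \[ \mathrm{vol}(\vec v)\ \ge\ \pi\, L(\varepsilon_k), \] where $L(\varepsilon_k)$ is the length of the ellipse $\varepsilon_k:\ \frac{x^2}{k^2}+\frac{y^2}{(k-2)^2}=1$, with $k>2$.
   Context: $I_{\vec v}(P)$ denotes the Poincaré index of $\vec v$ around the isolated singular point $P\in\{N,S\}$. The volume $\mathrm{vol}(\vec v)$ of the unit vector field is the area of the surface $\vec v(M)$ in the unit tangent bundle $T^1\mathbb{S}^2$ equipped with the Sasaki metric; equivalently, if $g$ is the round metric, $\nabla$ its Levi-Civita connection, $\nu$ the area form, and $\vec v^{\perp}$ is the unit vector field such that $\{\vec v^{\perp},\vec v\}$ is a positively oriented orthonormal frame, then \[ \mathrm{vol}(\vec v)=\int_M\sqrt{1+\gamma^2+\delta^2}\,\nu,\qquad \gamma=g(\nabla_{\vec v}\vec v,\vec v^{\perp}),\quad \delta=g(\nabla_{\vec v^{\perp}}\vec v^{\perp},\vec v). \] *)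

(* Defs.v *)
From HB Require Import structures.
From mathcomp Require Import all_boot all_order all_algebra.
From mathcomp Require Import all_classical all_reals all_analysis.
Set Implicit Arguments. Unset Strict Implicit. Unset Printing Implicit Defensive.
Import Order.TTheory GRing.Theory Num.Theory numFieldNormedType.Exports.
Local Open Scope classical_set_scope.
Local Open Scope ring_scope.

Section Sphere.
Variable R : realType.

Definition vec3 := (R * R * R)%type.
Definition vx (p : vec3) : R := p.1.1.
Definition vy (p : vec3) : R := p.1.2.
Definition vz (p : vec3) : R := p.2.
Definition mk3 (x y z : R) : vec3 := (x, y, z).
Definition dot3 (p q : vec3) : R := vx p * vx q + vy p * vy q + vz p * vz q.
Definition cross3 (p q : vec3) : vec3 :=
  mk3 (vy p * vz q - vz p * vy q) (vz p * vx q - vx p * vz q)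
      (vx p * vy q - vy p * vx q).
Definition add3 (p q : vec3) : vec3 := mk3 (vx p + vx q) (vy p + vy q) (vz p + vz q).
Definition scale3 (a : R) (p : vec3) : vec3 := mk3 (a * vx p) (a * vy p) (a * vz p).

Definition North : vec3 := mk3 0 0 1.
Definition South : vec3 := mk3 0 0 (-1).
Definition M : set vec3 := [set p | dot3 p p = 1 /\ p <> North /\ p <> South].

(* spherical chart: colatitude t in ]0,pi[, longitude s; it covers M *)
Definition sph (t s : R) : vec3 := mk3 (sin t * cos s) (sin t * sin s) (cos t).
Definition e_t (t s : R) : vec3 := mk3 (cos t * cos s) (cos t * sin s) (- sin t).
Definition e_s (t s : R) : vec3 := mk3 (- sin s) (cos s) 0.
Definition chart_dom : set (R * R) := [set z | 0 < z.1 < pi].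

Definition d1 (f : R -> R -> R) : R -> R -> R := fun t s => derive1 (fun u => f u s) t.
Definition d2 (f : R -> R -> R) : R -> R -> R := fun t s => derive1 (fun u => f t u) s.

Fixpoint Cn (n : nat) (U : set (R * R)) (f : R -> R -> R) : Prop :=
  match n with
  | 0%N => forall z, U z -> {for z, continuous (fun w : R * R => f w.1 w.2)}
  | n'.+1 => (forall z, U z -> derivable (fun u => f u z.2) z.1 1 /\
                               derivable (fun u => f z.1 u) z.2 1) /\
             Cn n' U f /\ Cn n' U (d1 f) /\ Cn n' U (d2 f)
  end.
Definition smooth_on (U : set (R * R)) (f : R -> R -> R) := forall n, Cn n U f.

(* a smooth unit tangent vector field on M: v is given at every point of R^3
   but only its values on M matter; smoothness is tested in the chart sph,
   which is a local diffeomorphism from ]0,pi[ x R onto M *)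
Definition smooth_unit_field (v : vec3 -> vec3) : Prop :=
  (forall p, M p -> dot3 (v p) p = 0 /\ dot3 (v p) (v p) = 1) /\
  smooth_on chart_dom (fun t s => vx (v (sph t s))) /\
  smooth_on chart_dom (fun t s => vy (v (sph t s))) /\
  smooth_on chart_dom (fun t s => vz (v (sph t s))).

Definition inchart (v : vec3 -> vec3) : R -> R -> vec3 := fun t s => v (sph t s).
Definition pd1 (F : R -> R -> vec3) : R -> R -> vec3 := fun t s =>
  mk3 (d1 (fun a b => vx (F a b)) t s) (d1 (fun a b => vy (F a b)) t s)
      (d1 (fun a b => vz (F a b)) t s).
Definition pd2 (F : R -> R -> vec3) : R -> R -> vec3 := fun t s =>
  mk3 (d2 (fun a b => vx (F a b)) t s) (d2 (fun a b => vy (F a b)) t s)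
      (d2 (fun a b => vz (F a b)) t s).

(* Euclidean directional derivative D_w X at sph t s of a field X given in the
   chart by F, along the tangent vector w (since d sph/dt = e_t and
   d sph/ds = sin t * e_s) *)
Definition dirder (F : R -> R -> vec3) (t s : R) (w : vec3) : vec3 :=
  add3 (scale3 (dot3 w (e_t t s)) (pd1 F t s))
       (scale3 (dot3 w (e_s t s) / sin t) (pd2 F t s)).

(* v^perp : {v^perp, v} positively oriented orthonormal (outward normal p),
   i.e. v^perp x v = p, i.e. v^perp = v x p *)
Definition vperp (v : vec3 -> vec3) : vec3 -> vec3 := fun p => cross3 (v p) p.

(* gamma = g(nabla_v v, v^perp), delta = g(nabla_{v^perp} v^perp, v); the
   Levi-Civita connection of the round sphere is the tangential part of the
   Euclidean derivative, and pairing with a tangent vector ignores the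
   normal part *)
Definition gam (v : vec3 -> vec3) (t s : R) : R :=
  dot3 (dirder (inchart v) t s (v (sph t s))) (vperp v (sph t s)).
Definition del (v : vec3 -> vec3) (t s : R) : R :=
  dot3 (dirder (inchart (vperp v)) t s (vperp v (sph t s))) (v (sph t s)).

Definition vol_dom : set (R * R) := `]0, pi[%classic `*` `]0, 2 * pi[%classic.
(* vol(v) = int_M sqrt(1 + gamma^2 + delta^2) dA, with dA = sin t dt ds *)
Definition vol (v : vec3 -> vec3) : \bar R :=
  (\int[(@lebesgue_measure R \x @lebesgue_measure R)%E]_(z in vol_dom)
     (Num.sqrt (1 + gam v z.1 z.2 ^+ 2 + del v z.1 z.2 ^+ 2) * sin z.1)%:E)%E.

Definition winding (cx cy : R -> R) (n : int) : Prop :=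
  exists th r : R -> R,
    {within `[0, 2 * pi]%classic, continuous th} /\
    (forall s, 0 <= s <= 2 * pi ->
       0 < r s /\ cx s = r s * cos (th s) /\ cy s = r s * sin (th s)) /\
    th (2 * pi) - th 0 = 2 * pi * n%:~R.

(* Poincare index at N: winding number of v, expressed in the (oriented)
   trivialisation given by orthogonal projection on the xy-plane, along small
   circles of colatitude eps around N (parametrised positively) *)
Definition index_N (v : vec3 -> vec3) (n : int) : Prop :=
  exists e0 : R, 0 < e0 /\ forall eps, 0 < eps < e0 ->
    winding (fun s => vx (v (sph eps s))) (fun s => vy (v (sph eps s))) n.
(* Poincare index at S: on the circle of colatitude pi - eps, increasing s
   is negatively oriented w.r.t. the outward normal, and the projection on
   the xy-plane is orientation reversing near S; the two sign changes cancel *)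
Definition index_S (v : vec3 -> vec3) (n : int) : Prop :=
  exists e0 : R, 0 < e0 /\ forall eps, 0 < eps < e0 ->
    winding (fun s => vx (v (sph (pi - eps) s))) (fun s => vy (v (sph (pi - eps) s))) n.

Definition seg (a b : R) : set R := `[a, b]%classic.
Definition curve_length (cx cy : R -> R) (a b : R) : \bar R :=
  (\int[@lebesgue_measure R]_(t in seg a b)
      (Num.sqrt ((derive1 cx t) ^+ 2 + (derive1 cy t) ^+ 2))%:E)%E.

Definition ellipse_length (k : R) : \bar R :=
  curve_length (fun t => k * cos t) (fun t => (k - 2) * sin t) 0 (2 * pi).

End Sphere.

(* Main.v *)
Require Import Defs.
From HB Require Import structures.
From mathcomp Require Import all_boot all_order all_algebra.
From mathcomp Require Import all_classical all_reals all_analysis.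
From mathcomp Require Import measurable_realfun ring lra.
Set Implicit Arguments. Unset Strict Implicit. Unset Printing Implicit Defensive.
Import Order.TTheory GRing.Theory Num.Theory numFieldNormedType.Exports.
Local Open Scope classical_set_scope.
Local Open Scope ring_scope.

(** Write v = cos phi e_t + sin phi e_s in the spherical frame.  Then the volume
    density is sqrt (sin^2 t + sin^2 t (d_t phi)^2 + (d_s phi + cos t)^2) dt ds, so
    dropping the d_t phi term only decreases it.  Along each parallel phi turns by
    2 pi m, where m does not depend on the parallel by continuity, and reading m off
    near the poles gives m = I(N) - 1 = 1 - I(S), hence m = k - 1 or m = 1 - k.  By
    convexity the integral over the parallel of colatitude t is at least
    2 pi sqrt (sin^2 t + (m + cos t)^2) = 2 pi sqrt (1 + m^2 + 2 m cos t).
    Integrating in t gives pi L(eps_k), because the ellipse has speed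
    sqrt (1 + (k - 1)^2 - 2 (k - 1) cos 2u). *)

(** * Primitives and angles *)

Section Calculus.
Variable R : realType.
Implicit Types (f g F : R -> R) (x y z a b A L s t : R).

Lemma is_derive1M f g x (f' g' : R) : is_derive x 1 f f' -> is_derive x 1 g g' ->
  is_derive x 1 (fun y => f y * g y) (f' * g x + f x * g').
Proof.
move=> df dg; apply: (is_derive_eq (is_deriveM df dg)).
by rewrite /GRing.scale/= addrC; congr (_ + _); rewrite mulrC.
Qed.

Lemma is_derive1D f g x (f' g' : R) : is_derive x 1 f f' -> is_derive x 1 g g' ->
  is_derive x 1 (fun y => f y + g y) (f' + g').
Proof. by move=> df dg; exact: (is_deriveD df dg). Qed.

Lemma is_derive1B f g x (f' g' : R) : is_derive x 1 f f' -> is_derive x 1 g g' ->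
  is_derive x 1 (fun y => f y - g y) (f' - g').
Proof. by move=> df dg; exact: (is_deriveB df dg). Qed.

Lemma is_derive1_compl f g x (f' g' : R) : is_derive x 1 g g' ->
  is_derive (g x) 1 f f' -> is_derive x 1 (fun y => f (g y)) (f' * g').
Proof.
by move=> dg df; apply: (is_derive_eq (is_derive1_comp df dg)).
Qed.

Lemma is_derive1_cos f x (f' : R) : is_derive x 1 f f' ->
  is_derive x 1 (fun y => cos (f y)) (- (f' * sin (f x))).
Proof.
move=> df; apply: (is_derive_eq (is_derive1_comp (is_derive_cos (f x)) df)).
by ring.
Qed.

Lemma is_derive1_sin f x (f' : R) : is_derive x 1 f f' ->
  is_derive x 1 (fun y => sin (f y)) (f' * cos (f x)).
Proof.
move=> df; apply: (is_derive_eq (is_derive1_comp (is_derive_sin (f x)) df)).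
by ring.
Qed.

Lemma is_derive1_derive1 f x (l : R) : is_derive x 1 f l -> derive1 f x = l.
Proof. by case=> _ <-; rewrite derive1E. Qed.

Lemma is_derive1_continuous f x (f' : R) : is_derive x 1 f f' ->
  {for x, continuous f}.
Proof.
by case=> df _; exact/differentiable_continuous/derivable1_diffP.
Qed.

Lemma is_derive0_cst_oo F a b x y :
  (forall z, a < z < b -> is_derive z 1 F 0) ->
  a < x < b -> a < y < b -> F x = F y.
Proof.
move=> dF; wlog xy : x y / x <= y => [H Ax Ay|/andP[ax xb] /andP[ay yb]].
  by case: (leP x y) => [/H|/ltW /H H']; [exact|rewrite H'].
have [z||c _] := @MVT_segment R F (fun=> 0) x y xy.
- rewrite in_itv/= => /andP[xz zy]; apply: dF.
  by rewrite (lt_trans ax xz) (lt_trans zy yb).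
- apply: derivable_within_continuous => z; rewrite in_itv/= => /andP[xz zy].
  have /dF[] // : a < z < b.
  by rewrite (lt_le_trans ax xz) (le_lt_trans zy yb).
- by rewrite mul0r => /eqP; rewrite subr_eq0 => /eqP ->.
Qed.

Lemma is_derive0_cst_oy F A x y : (forall z, A < z -> is_derive z 1 F 0) ->
  A < x -> A < y -> F x = F y.
Proof.
move=> dF Ax Ay; apply: (@is_derive0_cst_oo F A (Num.max x y + 1)).
- by move=> z /andP[Az _]; exact: dF.
- by rewrite Ax/= ltr_pwDr// le_max lexx.
- by rewrite Ay/= ltr_pwDr// le_max lexx orbT.
Qed.

(** The primitive is the integral from [A], so its derivative is controlled only to the right of
    [A]. It is used with [A = -1], which makes every point of [[0, 2 * pi]] interior. *)
Lemma primitive f A : continuous f ->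
  exists F, forall x, A < x -> is_derive x 1 F (f x).
Proof.
move=> cf.
exists (fun x => \int[lebesgue_measure]_(t in [set` `[A, x]]) (f t))%R => x Ax.
have := @continuous_FTC1_closed R f A x (x + 1).
case => //.
- by rewrite ltrDl.
- apply: continuous_compact_integrable; first exact: segment_compact.
  exact: continuous_subspaceT.
- exact: cf.
- by move=> dF dFE; apply: DeriveDef => //; rewrite -derive1E.
Qed.

Lemma FTC2_continuous f F a b : a < b -> continuous f ->
  (forall x, a <= x <= b -> is_derive x 1 F (f x)) ->
  (\int[lebesgue_measure]_(x in `[a, b]) (f x)%:E = (F b - F a)%:E)%E.
Proof.
move=> ab cf dF; have cF x : a <= x <= b -> {for x, continuous F}.
  by move=> /dF; exact: is_derive1_continuous.
rewrite (@continuous_FTC2 R f F a b ab) ?EFinB//.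
- exact: continuous_subspaceT.
- split.
  + move=> x; rewrite in_itv/= => /andP[ax xb].
    by case: (dF x); rewrite ?(ltW ax) ?(ltW xb).
  + by apply: cvg_at_right_filter; apply: cF; rewrite lexx ltW.
  + by apply: cvg_at_left_filter; apply: cF; rewrite lexx ltW.
- move=> x; rewrite in_itv/= => /andP[ax xb]; rewrite derive1E.
  by case: (dF x); rewrite ?(ltW ax) ?(ltW xb).
Qed.

Lemma unit_circle_angle (p q : R) : p ^+ 2 + q ^+ 2 = 1 ->
  exists th, p = cos th /\ q = sin th.
Proof.
move=> pq; have p1 : -1 <= p <= 1 by nra.
have E : q ^+ 2 = 1 - p ^+ 2 by lra.
have [q0|q0] := leP 0 q.
- exists (acos p); rewrite acosK ?in_itv//= sin_acos// -E sqrtr_sqr ger0_norm//.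
- exists (- acos p).
  by rewrite cosN sinN acosK ?in_itv//= sin_acos// -E sqrtr_sqr ltr0_norm// opprK.
Qed.

Lemma cosD2piz x (n : int) : cos (x + 2 * pi * n%:~R) = cos x.
Proof.
have H k y : cos (y + 2 * pi * k%:R) = cos y.
  rewrite -(periodicn (@cosD2pi R) k y); congr (cos (_ + _)).
  by rewrite mulr_natr mulr_natl.
case: (intP n) => [|k|k]; rewrite ?mulr0 ?addr0//; first exact: H.
by rewrite -(H k.+1 (x + _)); congr cos; rewrite mulrNz mulrN addrNK.
Qed.

Lemma cos_eq1 x : cos x = 1 -> exists n : int, x = 2 * pi * n%:~R.
Proof.
move=> cx; have pi0 := pi_gt0 R; pose n := Num.floor (x / (2 * pi)).
have /andP[n1 n2] := mem_rg1_floor (x / (2 * pi)).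
rewrite -/n in n1 n2.
rewrite ler_pdivlMr in n1; last lra.
rewrite ltr_pdivrMr in n2; last lra.
pose y := x - 2 * pi * n%:~R.
have cy : cos y = 1 by rewrite -(cosD2piz y n) /y subrK.
have y0 : 0 <= y by rewrite /y; lra.
have y2 : y < 2 * pi by rewrite /y; lra.
exists n; suff : y = 0 by rewrite /y; lra.
(* Cosine is injective on [[0, pi]] only. Beyond [pi] the reflected point [2 * pi - y] has the same
   cosine and would have to be 0, against [y < 2 * pi]. *)
have [yp|yp] := leP y pi.
  apply: cos_inj; rewrite ?in_itv/= ?cos0//; lra.
have : 2 * pi - y = 0; last lra.
apply: cos_inj; rewrite ?in_itv/= ?cos0//; try lra.
have -> : 2 * pi - y = - y + 2 * pi * 1%:~R by lra.
by rewrite cosD2piz cosN.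
Qed.

Lemma eq_cos_sin x y : cos x = cos y -> sin x = sin y ->
  exists n : int, x - y = 2 * pi * n%:~R.
Proof.
move=> cxy sxy; apply: cos_eq1; rewrite cosB cxy sxy -!expr2.
exact: cos2Dsin2.
Qed.

(* The intermediate value theorem would produce a point where the angle has
   moved by exactly pi, and there the cosine has changed sign. *)
Lemma cos_gt0_no_turn (D : R -> R) L (n : int) : 0 <= L ->
  {within `[0, L]%classic, continuous D} ->
  (forall s, 0 <= s <= L -> 0 < cos (D s)) ->
  D L - D 0 = 2 * pi * n%:~R -> n = 0.
Proof.
move=> L0 cD cosD DL; have pi0 := pi_gt0 R.
have key v : (v = D 0 + pi \/ v = D 0 - pi) ->
    Num.min (D 0) (D L) <= v <= Num.max (D 0) (D L) -> False.
  move=> vE /(IVT L0 cD)[c]; rewrite in_itv/= => cL Dc.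
  have := cosD c cL; have : 0 < cos (D 0) by apply: cosD; rewrite lexx.
  have cE : cos v = - cos (D 0).
    case: vE => ->; first exact: cosDpi.
    by rewrite -(opprK (cos _)) -cosDpi subrK.
  by rewrite Dc cE; lra.
(* A nonzero [n] moves [D] by at least [2 * pi], so [D 0 - pi] or [D 0 + pi], according to the sign
   of [n], lies between the end values. *)
case: (ltgtP n 0) => // n0; exfalso.
- have {}n0 : (n%:~R : R) <= -1.
    rewrite -(_ : (-1)%:~R = -1 :> R); last by rewrite mulrNz.
    by rewrite ler_int; move: n0; case: n {DL} => // k _.
  have ? : D L - D 0 <= - (2 * pi) by nra.
  apply: (key (D 0 - pi)); first by right.
  rewrite ge_min le_max; apply/andP; split; apply/orP; [right|left]; lra.
- have {}n0 : 1 <= (n%:~R : R) by rewrite (_ : 1 = 1%:~R)// ler_int; case: n {DL} n0 => // -[].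
  have ? : 2 * pi <= D L - D 0 by nra.
  apply: (key (D 0 + pi)); first by left.
  rewrite ge_min le_max; apply/andP; split; apply/orP; [left|right]; lra.
Qed.

(** The angle is the integral of the angular speed, started at an angle of the point at 0. It stays
    an angle of the curve because, in the frame rotating with [phi], the curve does not move. *)
Lemma unit_circle_lift (p q p' q' : R -> R) :
  (forall s, is_derive s 1 p (p' s)) -> (forall s, is_derive s 1 q (q' s)) ->
  continuous p' -> continuous q' -> (forall s, p s ^+ 2 + q s ^+ 2 = 1) ->
  exists phi, forall s, -1 < s ->
    [/\ is_derive s 1 phi (p s * q' s - q s * p' s),
        p s = cos (phi s) & q s = sin (phi s)].
Proof.
move=> dp dq cp' cq' pq.
have cp : continuous p by move=> s; exact: is_derive1_continuous (dp s).
have cq : continuous q by move=> s; exact: is_derive1_continuous (dq s).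
have [|F dF] := @primitive (fun s => p s * q' s - q s * p' s) (-1).
  move=> s; apply: cvgB; apply: cvgM;
    by [exact: cp|exact: cq|exact: cp'|exact: cq'].
have [th [p0 q0]] := unit_circle_angle (pq 0).
pose phi s := F s + (th - F 0).
have dphi s : -1 < s -> is_derive s 1 phi (p s * q' s - q s * p' s).
  move=> s1; apply: (is_derive_eq (is_derive1D (dF s s1) (is_derive_cst _ s 1))).
  by rewrite addr0.
have pp s : p s * p' s + q s * q' s = 0.
  have := is_derive1D (is_derive1M (dp s) (dp s)) (is_derive1M (dq s) (dq s)).
  have -> : (fun y => p y * p y + q y * q y) = cst 1.
    by apply/funext => y; rewrite -!expr2 pq.
  by case=> _; rewrite derive_cst; lra.
(* By [pp] the velocity is orthogonal to the position, hence it is the position turned by a right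
   angle and multiplied by the angular speed. *)
have pE s : p' s = - ((p s * q' s - q s * p' s) * q s).
  transitivity ((p s ^+ 2 + q s ^+ 2) * p' s - p s * (p s * p' s + q s * q' s)).
    by rewrite pq pp mulr0 subr0 mul1r.
  ring.
have qE s : q' s = (p s * q' s - q s * p' s) * p s.
  transitivity ((p s ^+ 2 + q s ^+ 2) * q' s - q s * (p s * p' s + q s * q' s)).
    by rewrite pq pp mulr0 subr0 mul1r.
  ring.
have m10 : -1 < 0 :> R by rewrite ltrN10.
have phi0 : phi 0 = th by rewrite /phi addrC subrK.
(* [U] and [W] give the coordinates of the curve in the rotating frame; both are constant, with
   values 1 and 0 read off at [s = 0]. *)
have U s : -1 < s -> p s * cos (phi s) + q s * sin (phi s) = 1.
  have dU z : -1 < z ->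
      is_derive z 1 (fun s => p s * cos (phi s) + q s * sin (phi s)) 0; last first.
    by move=> s1; have /= -> := is_derive0_cst_oy dU s1 m10; rewrite phi0 p0 q0 -!expr2 cos2Dsin2.
  move=> z1; apply: is_derive_eq.
    apply: is_derive1D; apply: is_derive1M; try exact: dp; try exact: dq.
    - exact: is_derive1_cos (dphi z z1).
    - exact: is_derive1_sin (dphi z z1).
  by have := pE z; have := qE z; set r := (_ - _) => -> ->; ring.
have W s : -1 < s -> q s * cos (phi s) - p s * sin (phi s) = 0.
  have dU z : -1 < z ->
      is_derive z 1 (fun s => q s * cos (phi s) - p s * sin (phi s)) 0; last first.
    by move=> s1; have /= -> := is_derive0_cst_oy dU s1 m10; rewrite phi0 p0 q0; ring.
  move=> z1; apply: is_derive_eq.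
    apply: is_derive1B; apply: is_derive1M; try exact: dp; try exact: dq.
    - exact: is_derive1_cos (dphi z z1).
    - exact: is_derive1_sin (dphi z z1).
  by have := pE z; have := qE z; set r := (_ - _) => -> ->; ring.
exists phi => s s1; split; first exact: dphi.
- transitivity (p s * (cos (phi s) ^+ 2 + sin (phi s) ^+ 2)).
    by rewrite cos2Dsin2 mulr1.
  transitivity ((p s * cos (phi s) + q s * sin (phi s)) * cos (phi s) -
    (q s * cos (phi s) - p s * sin (phi s)) * sin (phi s)); first ring.
  by rewrite U// W// mul0r subr0 mul1r.
- transitivity (q s * (cos (phi s) ^+ 2 + sin (phi s) ^+ 2)).
    by rewrite cos2Dsin2 mulr1.
  transitivity ((p s * cos (phi s) + q s * sin (phi s)) * sin (phi s) +
    (q s * cos (phi s) - p s * sin (phi s)) * cos (phi s)); first ring.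
  by rewrite U// W// mul0r addr0 mul1r.
Qed.

(** Local constancy gives derivative zero, so the mean value theorem takes the place of a
    connectedness argument. *)
Lemma locally_cst_itv (h : R -> R) a b :
  (forall t, a < t < b -> \forall u \near t, h u = h t) ->
  forall x y, a < x < b -> a < y < b -> h x = h y.
Proof.
move=> lh x y; apply: is_derive0_cst_oo => t /lh ht.
apply: (near_eq_is_derive (f := cst (h t))).
by near=> u; rewrite /cst; apply/esym; near: u.
Unshelve. all: by end_near. Qed.

End Calculus.

(** * Integration over a rectangle *)

Section Measure.
Variable R : realType.

(** The product sigma-algebra is generated by rectangles rather than by open sets; the countably
    many rational boxes bridge the two. *)
Lemma open_measurable_prod (U : set (measurableTypeR R * measurableTypeR R)) :
  @open (R * R)%type U -> measurable U.
Proof.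
move=> oU.
pose box (q : (rat * rat) * (rat * rat)) : set (measurableTypeR R * measurableTypeR R) :=
  `]ratr q.1.1, ratr q.1.2[%classic `*` `]ratr q.2.1, ratr q.2.2[%classic.
have -> : U = \bigcup_(q in [set q | box q `<=` U]) box q.
  apply/seteqP; split => [[x y] Uxy|z [q /= qU qz]]; last exact: qU.
  have /nbhs_ballP[e /= e0 eU] : nbhs ((x, y) : R * R) U.
    by apply: open_nbhs_nbhs; split.
  have sep z : exists q : rat * rat, z - e < ratr q.1 < z /\ z < ratr q.2 < z + e.
    have [|q1 q1z] := @rat_in_itvoo R (z - e) z; first by rewrite ltrBlDr ltrDl.
    have [|q2 q2z] := @rat_in_itvoo R z (z + e); first by rewrite ltrDl.
    by exists (q1, q2); move: q1z q2z; rewrite !in_itv.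
  have [qx [/andP[x1 x2] /andP[x3 x4]]] := sep x.
  have [qy [/andP[y1 y2] /andP[y3 y4]]] := sep y.
  exists (qx, qy); last by split => /=; rewrite in_itv/= ?x2 ?x3 ?y2 ?y3.
  move=> [u w] [/=]; rewrite !in_itv/= => /andP[u1 u2] /andP[w1 w2].
  apply: eU; split => /=; rewrite /ball/= ltr_norml; lra.
rewrite bigcup_mkcond; apply: countable_bigcupT_measurable => [|q].
  exact: countableP.
by case: ifPn => // _; apply: measurableX; exact: measurable_itv.
Qed.

Lemma open_continuous_measurable_fun_prod
    (D : set (measurableTypeR R * measurableTypeR R)) (h : R * R -> R) :
  @open (R * R)%type D -> (forall z : R * R, D z -> {for z, continuous h}) ->
  measurable_fun D h.
Proof.
move=> oD ch; move=> mD; apply: (measurability _ (RGenOpens.measurableE R)) => //.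
move=> _ [_ [a [b ->] <-]]; apply: open_measurable_prod.
rewrite openE => z [Dz hz]; apply: filterI.
  by apply: open_nbhs_nbhs; split.
apply: (ch z Dz); apply: open_nbhs_nbhs; split => //; exact: interval_open.
Qed.

(** The integral of a nonnegative function is a supremum over the simple functions below it, and a
    larger function has more of these. In this form the comparison applies directly to the volume
    density. *)
Lemma ge0_le_integral_nonmeas d (T : measurableType d)
    (mu : {measure set T -> \bar R}) (D : set T) (h1 h2 : T -> \bar R) :
  (forall x, D x -> (0 <= h1 x)%E) -> (forall x, D x -> (h1 x <= h2 x)%E) ->
  (\int[mu]_(x in D) h1 x <= \int[mu]_(x in D) h2 x)%E.
Proof.
move=> h10 h12; rewrite !ge0_integralE//; last first.
  by move=> x Dx; exact: le_trans (h10 x Dx) (h12 x Dx).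
apply: ereal_sup_le => _ /= [h hle <-]; exists h => // x.
by apply: le_trans (hle x) _; apply: lee_restrict.
Qed.

(** Tonelli's theorem puts the integral over the second variable inside, where the slice hypothesis
    applies. *)
Lemma le_integral_rectangle (a b c d : R) (G : R * R -> R) (H : R -> R) :
  (forall z, a < z.1 < b -> {for z, continuous G}) ->
  (forall z, 0 <= G z) -> (forall t, 0 <= H t) ->
  (forall t, a < t < b ->
    ((H t)%:E <= \int[lebesgue_measure]_(s in `]c, d[) (G (t, s))%:E)%E) ->
  (\int[lebesgue_measure]_(t in `]a, b[) (H t)%:E <=
   \int[(@lebesgue_measure R \x @lebesgue_measure R)%E]_(z in `]a, b[%classic `*` `]c, d[%classic)
     (G z)%:E)%E.
Proof.
move=> cG G0 H0 HG.
set D := (X in (_ <= integral _ X _)%E).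
have oD : @open (R * R)%type D.
  rewrite openE => -[x y] [/= xab ycd].
  exists (`]a, b[%classic, `]c, d[%classic) => //.
  by split; apply: open_nbhs_nbhs; split => //; exact: interval_open.
have mG : measurable_fun D (EFin \o G).
  apply/measurable_EFinP; apply: open_continuous_measurable_fun_prod => // z [].
  by rewrite /= in_itv/= => zab _; exact: cG.
have mD : measurable D by exact: open_measurable_prod.
rewrite [in leRHS]integral_mkcond [in leLHS]integral_mkcond fubini_tonelli1; last 2 first.
- exact/(measurable_restrictT _ _).1.
- by move=> z; apply: erestrict_ge0 => w _; rewrite lee_fin.
apply: ge0_le_integral_nonmeas => x _.
  by apply: erestrict_ge0 => w _; rewrite lee_fin.
rewrite /fubini_F; have [xab|xab] := boolP (a < x < b); last first.
  rewrite patchE ifF; last by apply/negbTE; rewrite notin_setE/= in_itv/=; exact/negP.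
  by apply: integral_ge0 => y _; apply: erestrict_ge0 => w _; rewrite lee_fin.
rewrite patchE ifT; last by rewrite inE/= in_itv.
apply: (le_trans (HG x xab)); rewrite [in leLHS]integral_mkcond.
rewrite le_eqVlt; apply/orP; left; apply/eqP; apply: eq_integral => y _.
rewrite !patchE /D; congr (if _ then _ else _).
by apply/idP/idP; rewrite !inE /= ?in_itv/= => // -[].
Qed.

End Measure.

(** * The length of the ellipse *)

Section Ellipse.
Variable R : realType.
Implicit Types (w x y z t c : R).

Lemma sqrt_chord_continuous (m : R) :
  continuous (fun w => Num.sqrt (1 + m ^+ 2 + 2 * m * cos w)).
Proof.
move=> w; apply: (@continuous_comp _ _ _ (fun w => 1 + m ^+ 2 + 2 * m * cos w) Num.sqrt);
  last exact: sqrt_continuous.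
by apply: cvgD; [exact: cvg_cst|apply: cvgM; [exact: cvg_cst|exact: continuous_cos]].
Qed.

(** The integrand is the distance from [- m] on the horizontal axis to the point of angle [w] on the
    unit circle. It is [2 * pi]-periodic, which gives the second clause, and symmetric about [pi],
    which gives the third. *)
Lemma sqrt_chord_primitive (m : R) :
  exists Q : R -> R,
    [/\ forall w, -1 < w -> is_derive w 1 Q (Num.sqrt (1 + m ^+ 2 + 2 * m * cos w)),
        forall c, 0 <= c -> Q (2 * (2 * pi) + c) - Q c = 2 * (Q (2 * pi) - Q 0) &
        Q (2 * pi) - Q 0 = 2 * (Q pi - Q 0)].
Proof.
pose q w : R := Num.sqrt (1 + m ^+ 2 + 2 * m * cos w).
have cq : continuous q by exact: sqrt_chord_continuous.
have pi0 := pi_gt0 R.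
have [Q dQ] := primitive (-1) cq.
have per x y : -1 < x -> -1 < y ->
    Q (x + 2 * pi) - Q x = Q (y + 2 * pi) - Q y.
  have dP z : -1 < z -> is_derive z 1 (fun x => Q (x + 2 * pi) - Q x) 0.
    move=> z1; have z2 : -1 < z + 2 * pi by lra.
    have dz : is_derive z 1 (fun x => x + 2 * pi) 1.
      apply: (is_derive_eq (is_derive1D (is_derive_id z 1) (is_derive_cst _ z 1))).
      by rewrite addr0.
    apply: (is_derive_eq (is_derive1B (is_derive1_compl dz (dQ _ z2)) (dQ z z1))).
    have -> : q (z + 2 * pi) = q z.
      by rewrite /q -(cosD2piz z 1) mulr1.
    by rewrite mulr1 subrr.
  exact: (is_derive0_cst_oy dP).
(* The sum [Q (pi + x) + Q (pi - x)] is constant by symmetry; it is compared at [x = 0] and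
   [x = pi]. The bounds on [z] keep both arguments above -1. *)
have even : Q (pi + 0) + Q (pi - 0) = Q (pi + pi) + Q (pi - pi).
  have dP z : - pi - 1 < z < pi + 1 ->
      is_derive z 1 (fun x => Q (pi + x) + Q (pi - x)) 0.
    move=> /andP[z1 z2].
    have dz : is_derive z 1 (fun x => pi + x) 1.
      apply: (is_derive_eq (is_derive1D (is_derive_cst _ z 1) (is_derive_id z 1))).
      by rewrite add0r.
    have dz' : is_derive z 1 (fun x => pi - x) (-1).
      apply: (is_derive_eq (is_derive1B (is_derive_cst _ z 1) (is_derive_id z 1))).
      by rewrite sub0r.
    have z3 : -1 < pi + z by lra.
    have z4 : -1 < pi - z by lra.
    apply: (is_derive_eq (is_derive1D (is_derive1_compl dz (dQ _ z3))
                                      (is_derive1_compl dz' (dQ _ z4)))).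
    have -> : q (pi - z) = q (pi + z).
      rewrite /q -(cosN (pi + z)) -(cosD2piz (- (pi + z)) 1).
      by congr (Num.sqrt (_ + _ * cos _)); lra.
    by rewrite mulr1 mulrN1 subrr.
  by apply: (is_derive0_cst_oo dP); lra.
exists Q; split => [w w1|c c0|]; first exact: dQ.
- have := per c 0; have := per (c + 2 * pi) 0.
  rewrite add0r (_ : 2 * (2 * pi) + c = c + 2 * pi + 2 * pi); last by lra.
  move=> H1 H2; have : -1 < c + 2 * pi by lra.
  move=> /H1 {}H1; have : -1 < c by lra.
  by move=> /H2 {}H2; move: (H1 (ltrN10 R)) (H2 (ltrN10 R)); lra.
- move: even; rewrite addr0 subr0 subrr (_ : pi + pi = 2 * pi :> R); last by lra.
  by lra.
Qed.

(** With [a = k - 1] the coefficients are [a + 1] and [a - 1]: the squares add up to [1 + a ^+ 2]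
    and the cross terms form a double angle. *)
Lemma ellipse_speed (k t : R) :
  (derive1 (fun t => k * cos t) t) ^+ 2 + (derive1 (fun t => (k - 2) * sin t) t) ^+ 2
  = 1 + (k - 1) ^+ 2 - 2 * (k - 1) * cos (2 * t).
Proof.
have d1 : is_derive t 1 (fun t => k * cos t) (k * - sin t).
  apply: (is_derive_eq (is_derive1M (is_derive_cst k t 1) (is_derive_cos t))).
  by rewrite mul0r add0r.
have d2 : is_derive t 1 (fun t => (k - 2) * sin t) ((k - 2) * cos t).
  apply: (is_derive_eq (is_derive1M (is_derive_cst (k - 2) t 1) (is_derive_sin t))).
  by rewrite mul0r add0r.
rewrite !derive1E (@derive_val _ _ _ _ _ _ _ d1) (@derive_val _ _ _ _ _ _ _ d2).
rewrite (_ : cos (2 * t) = cos t ^+ 2 - sin t ^+ 2); last first.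
  by rewrite mulr_natl mulr2n cosD -!expr2.
have := cos2Dsin2 t; set c := cos t; set s := sin t => cs.
have c2 : c ^+ 2 = 1 - s ^+ 2 by lra.
by rewrite exprMn sqrrN exprMn c2; ring.
Qed.

(** The substitution [w = 2 * t] turns the speed of the ellipse into the chord integrand. The sign
    of [m] is immaterial, since a shift of [w] by [pi] reverses it. *)
Lemma pi_ellipse_lengthE (k m : R) : m = k - 1 \/ m = 1 - k ->
  (pi%:E * ellipse_length k =
   \int[lebesgue_measure]_(t in `]0%R, pi[)
     (2 * pi * Num.sqrt (1 + m ^+ 2 + 2 * m * cos t))%:E)%E.
Proof.
move=> mk; have pi0 := pi_gt0 R.
have [Q [dQ per half]] := sqrt_chord_primitive m.
pose q w : R := Num.sqrt (1 + m ^+ 2 + 2 * m * cos w).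
have cq : continuous q by exact: sqrt_chord_continuous.
have [c [c0 cE]] : exists c : R, 0 <= c /\
    forall t, 1 + (k - 1) ^+ 2 - 2 * (k - 1) * cos (2 * t) =
              1 + m ^+ 2 + 2 * m * cos (2 * t + c).
  case: mk => ->.
  - by exists pi; split => [|t]; [exact: ltW|rewrite cosDpi; ring].
  - by exists 0; split => // t; rewrite addr0; ring.
rewrite /ellipse_length /curve_length /seg.
under eq_integral do rewrite ellipse_speed cE.
have pi2 : 0 < 2 * pi :> R by lra.
have cq' : continuous (fun t => q (2 * t + c)).
  move=> t; apply: (@continuous_comp _ _ _ (fun t => 2 * t + c) q); last exact: cq.
  by apply: cvgD; [apply: cvgM; [exact: cvg_cst|exact: cvg_id]|exact: cvg_cst].
have dE t : 0 <= t <= 2 * pi ->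
    is_derive t 1 (fun t => 2^-1 * Q (2 * t + c)) (q (2 * t + c)).
  move=> /andP[t0 t2].
  have dt : is_derive t 1 (fun t => 2 * t + c) 2.
    apply: (is_derive_eq (is_derive1D (is_derive1M (is_derive_cst (2 : R) t 1)
      (is_derive_id t 1)) (is_derive_cst c t 1))).
    by rewrite mul0r add0r addr0 mulr1.
  have t1 : -1 < 2 * t + c by lra.
  apply: (is_derive_eq (is_derive1M (is_derive_cst (2^-1 : R) t 1)
    (is_derive1_compl dt (dQ _ t1)))).
  by rewrite mul0r add0r /cst -/(q _); field.
rewrite (FTC2_continuous pi2 cq' dE).
have cq2 : continuous (fun t => 2 * pi * q t).
  by move=> t; apply: cvgM; [exact: cvg_cst|exact: cq].
have <- := @integral_itv_bndoo R 0 pi (EFin \o (fun t => 2 * pi * q t)) true false; last first.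
  by apply/measurable_EFinP; apply: measurable_funTS; exact: continuous_measurable_fun.
have dH t : 0 <= t <= pi -> is_derive t 1 (fun t => 2 * pi * Q t) (2 * pi * q t).
  move=> /andP[t0 t2]; have t1 : -1 < t by lra.
  apply: (is_derive_eq (is_derive1M (is_derive_cst (2 * pi) t 1) (dQ _ t1))).
  by rewrite mul0r add0r.
rewrite (FTC2_continuous pi0 cq2 dH).
(* One tour of the ellipse covers two periods of [q], hence four half-periods; the factor [2^-1] of
   the substitution leaves 2. *)
by rewrite -EFinM; congr EFin; rewrite mulr0 add0r -mulrBr per// half; field.
Qed.

End Ellipse.

(** * The field in the spherical frame *)

Lemma dot3_lincomb (R : realType) (a b : R) (p q w : vec3 R) :
  dot3 (add3 (scale3 a p) (scale3 b q)) w = a * dot3 p w + b * dot3 q w.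
Proof. by rewrite /dot3 /add3 /scale3 /vx /vy /vz /=; ring. Qed.

Lemma trig_chart_continuous (R : realType) (t s : R) :
  [/\ {for (t, s), continuous (fun w : R * R => cos w.1)},
      {for (t, s), continuous (fun w : R * R => sin w.1)},
      {for (t, s), continuous (fun w : R * R => cos w.2)} &
      {for (t, s), continuous (fun w : R * R => sin w.2)}].
Proof.
have c1 f : continuous f -> {for (t, s), continuous (fun w : R * R => f w.1 : R)}.
  by move=> cf; apply: continuous_comp; [exact: cvg_fst|exact: cf].
have c2 f : continuous f -> {for (t, s), continuous (fun w : R * R => f w.2 : R)}.
  by move=> cf; apply: continuous_comp; [exact: cvg_snd|exact: cf].
by split; [apply: c1|apply: c1|apply: c2|apply: c2];
  [exact: continuous_cos|exact: continuous_sin|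
   exact: continuous_cos|exact: continuous_sin].
Qed.

Lemma slice_continuous (R : realType) (f : R -> R -> R) (t s : R) :
  {for (t, s), continuous (fun w : R * R => f w.1 w.2)} ->
  {for s, continuous (f t)}.
Proof.
move=> cf; apply: (@continuous_comp _ _ _ (fun u => (t, u))
  (fun w : R * R => f w.1 w.2)) cf.
by apply: (@cvg_pair _ _ _ (nbhs s) (nbhs t) (nbhs s));
  [exact: cvg_cst|exact: cvg_id].
Qed.

Lemma smooth_on_C1 (R : realType) (U : set (R * R)) (f : R -> R -> R) :
  smooth_on U f -> forall t s, U (t, s) ->
  [/\ is_derive t 1 (fun u => f u s) (d1 f t s),
      is_derive s 1 (fun u => f t u) (d2 f t s),
      {for (t, s), continuous (fun w : R * R => f w.1 w.2)} &
      {for (t, s), continuous (fun w : R * R => d2 f w.1 w.2)}].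
Proof.
move=> /(_ 1%N)[df [cf [_ c2]]] t s Uts; have [dt ds] := df _ Uts.
split; [| |exact: cf|exact: c2].
- by rewrite /d1 derive1E; exact: derivableP.
- by rewrite /d2 derive1E; exact: derivableP.
Qed.

Section ChartFrame.
Variables (R : realType) (v : vec3 R -> vec3 R).
Hypothesis sv : smooth_unit_field v.
Implicit Types (t s u : R).

Let X t s := vx (v (sph t s)).
Let Y t s := vy (v (sph t s)).
Let Z t s := vz (v (sph t s)).

Definition comp_t t s := dot3 (v (sph t s)) (e_t t s).
Definition comp_s t s := dot3 (v (sph t s)) (e_s t s).

(* If v makes the angle phi with e_t in the frame (e_t, e_s), then turn_speed
   is - (d phi / ds + cos t): the sign comes from the convention v^perp = v x p. *)
Definition turn_speed t s := dot3 (pd2 (inchart v) t s) (vperp v (sph t s)).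

Let inch t s : 0 < t < pi -> @chart_dom R (t, s). Proof. by []. Qed.

Let sX := let: conj _ (conj h _) := sv in smooth_on_C1 h.
Let sY := let: conj _ (conj _ (conj h _)) := sv in smooth_on_C1 h.
Let sZ := let: conj _ (conj _ (conj _ h)) := sv in smooth_on_C1 h.

Lemma sph_in_M t s : 0 < t < pi -> M (sph t s).
Proof.
move=> t0; have st : 0 < sin t by exact: sin_gt0_pi.
have := cos2Dsin2 t => cs.
split.
  rewrite /dot3 /sph /vx /vy /vz /mk3/= -!expr2 !exprMn -mulrDr cos2Dsin2 mulr1.
  by rewrite addrC.
by split; rewrite /North /South /sph /mk3 => -[_ _ h]; move: cs; rewrite h; nra.
Qed.

Lemma field_unit t s : 0 < t < pi ->
  X t s ^+ 2 + Y t s ^+ 2 + Z t s ^+ 2 = 1.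
Proof. by move=> /(sph_in_M s) /(proj1 sv)[_]; rewrite /dot3 -!expr2. Qed.

Lemma field_tangent t s : 0 < t < pi ->
  X t s * (sin t * cos s) + Y t s * (sin t * sin s) + Z t s * cos t = 0.
Proof. by move=> /(sph_in_M s) /(proj1 sv)[]. Qed.

Lemma comp_tE t s : comp_t t s =
  X t s * (cos t * cos s) + Y t s * (cos t * sin s) - Z t s * sin t.
Proof. by rewrite /comp_t /dot3 /= /X /Y /Z mulrN. Qed.

Lemma comp_sE t s : comp_s t s = Y t s * cos s - X t s * sin s.
Proof. by rewrite /comp_s /dot3 /= /X /Y mulr0 addr0 mulrN addrC. Qed.

(** The vectors [e_t], [e_s] and [sph t s] form an orthonormal basis, and tangency kills the third
    coordinate of [v]. *)
Lemma comp_unit t s : 0 < t < pi -> comp_t t s ^+ 2 + comp_s t s ^+ 2 = 1.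
Proof.
move=> t0; have := field_tangent s t0; have := field_unit s t0.
rewrite comp_tE comp_sE; set x := X t s; set y := Y t s; set z := Z t s => u n.
transitivity ((x ^+ 2 + y ^+ 2) * (cos s ^+ 2 + sin s ^+ 2) + z ^+ 2); last first.
  by rewrite cos2Dsin2 mulr1.
transitivity (((x * cos s + y * sin s) ^+ 2 + z ^+ 2) * (cos t ^+ 2 + sin t ^+ 2)
  + (y * cos s - x * sin s) ^+ 2 -
  (x * (sin t * cos s) + y * (sin t * sin s) + z * cos t) ^+ 2); first ring.
by rewrite n cos2Dsin2; ring.
Qed.

(** In the horizontal radial direction [e_s] has no component and [e_t] has [cos t]. The sign of
    [cos t] is what distinguishes the two poles in the index computations. *)
Lemma comp_radial t s : 0 < t < pi ->
  X t s * cos s + Y t s * sin s = cos t * comp_t t s.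
Proof.
move=> /(field_tangent s) n; rewrite comp_tE.
transitivity ((X t s * cos s + Y t s * sin s) * (cos t ^+ 2 + sin t ^+ 2) -
  (X t s * (sin t * cos s) + Y t s * (sin t * sin s) + Z t s * cos t) * sin t).
  by rewrite n cos2Dsin2; ring.
ring.
Qed.

Lemma comp_2pi t : comp_t t (2 * pi) = comp_t t 0 /\ comp_s t (2 * pi) = comp_s t 0.
Proof.
have c2 : cos (2 * pi) = cos 0 :> R by rewrite -(cosD2piz 0 1) mulr1 add0r.
have s2 : sin (2 * pi) = sin 0 :> R by rewrite -(sinD2pi 0) add0r mulr_natl.
have E : sph t (2 * pi) = sph t 0 by rewrite /sph c2 s2.
by rewrite /comp_t /comp_s /e_t /e_s E c2 s2.
Qed.

Let comp_t' t s := d2 X t s * (cos t * cos s) - X t s * (cos t * sin s) +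
  d2 Y t s * (cos t * sin s) + Y t s * (cos t * cos s) - d2 Z t s * sin t.
Let comp_s' t s := d2 Y t s * cos s - Y t s * sin s - d2 X t s * sin s - X t s * cos s.

Lemma is_derive_comp_t t s : 0 < t < pi ->
  is_derive s 1 (comp_t t) (comp_t' t s).
Proof.
move=> t0; rewrite (_ : comp_t t = fun s => X t s * (cos t * cos s) +
  Y t s * (cos t * sin s) - Z t s * sin t); last by apply/funext => u; exact: comp_tE.
have [_ dX _ _] := sX (inch s t0); have [_ dY _ _] := sY (inch s t0).
have [_ dZ _ _] := sZ (inch s t0).
apply: (is_derive_eq (is_derive1B (is_derive1D
  (is_derive1M dX (is_derive1M (is_derive_cst (cos t) s 1) (is_derive_cos s)))
  (is_derive1M dY (is_derive1M (is_derive_cst (cos t) s 1) (is_derive_sin s))))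
  (is_derive1M dZ (is_derive_cst (sin t) s 1)))).
rewrite /comp_t' /cst -/(X t s) -/(Y t s) -/(Z t s) -/X -/Y -/Z; ring.
Qed.

Lemma is_derive_comp_s t s : 0 < t < pi ->
  is_derive s 1 (comp_s t) (comp_s' t s).
Proof.
move=> t0; rewrite (_ : comp_s t = fun s => Y t s * cos s - X t s * sin s);
  last by apply/funext => u; exact: comp_sE.
have [_ dX _ _] := sX (inch s t0); have [_ dY _ _] := sY (inch s t0).
apply: (is_derive_eq (is_derive1B (is_derive1M dY (is_derive_cos s))
                                  (is_derive1M dX (is_derive_sin s)))).
rewrite /comp_s' -/(X t s) -/(Y t s) -/X -/Y; ring.
Qed.

(** The left side is the angular speed of [v] relative to the frame [(e_t, e_s)], which itself
    rotates at speed [cos t] in the tangent plane along the parallel. *)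
Lemma turn_speedE t s : 0 < t < pi ->
  comp_t t s * comp_s' t s - comp_s t s * comp_t' t s = - turn_speed t s - cos t.
Proof.
move=> t0; have cu := comp_unit s t0; have cr := comp_radial s t0.
have -> : turn_speed t s =
    d2 X t s * (Y t s * cos t - Z t s * (sin t * sin s)) +
    d2 Y t s * (Z t s * (sin t * cos s) - X t s * cos t) +
    d2 Z t s * (X t s * (sin t * sin s) - Y t s * (sin t * cos s)) by [].
(* The terms without [d2] come from the motion of the frame; they collapse to [- cos t] by
   [comp_sE], [comp_radial] and [comp_unit]. *)
transitivity (- (d2 X t s * (comp_t t s * sin s + comp_s t s * (cos t * cos s))) +
    d2 Y t s * (comp_t t s * cos s - comp_s t s * (cos t * sin s)) +
    d2 Z t s * (comp_s t s * sin t) -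
    comp_t t s * (X t s * cos s + Y t s * sin s) -
    cos t * comp_s t s * (Y t s * cos s - X t s * sin s)).
  by rewrite /comp_s' /comp_t'; ring.
rewrite -comp_sE cr.
transitivity (- (d2 X t s * (comp_t t s * sin s + comp_s t s * (cos t * cos s))) +
    d2 Y t s * (comp_t t s * cos s - comp_s t s * (cos t * sin s)) +
    d2 Z t s * (comp_s t s * sin t) - cos t * (comp_t t s ^+ 2 + comp_s t s ^+ 2)).
  by ring.
rewrite cu mulr1.
have -> : comp_t t s * sin s + comp_s t s * (cos t * cos s) =
    Y t s * cos t * (cos s ^+ 2 + sin s ^+ 2) - Z t s * (sin t * sin s).
  by rewrite comp_tE comp_sE; ring.
have -> : comp_t t s * cos s - comp_s t s * (cos t * sin s) =
    X t s * cos t * (cos s ^+ 2 + sin s ^+ 2) - Z t s * (sin t * cos s).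
  by rewrite comp_tE comp_sE; ring.
by rewrite cos2Dsin2 comp_sE; ring.
Qed.

Lemma vperp_dot_e_t t s : dot3 (vperp v (sph t s)) (e_t t s) = comp_s t s.
Proof.
rewrite comp_sE /vperp /cross3 /dot3 /sph /e_t /e_s /vx /vy /vz /=.
rewrite -[RHS]mulr1 -(cos2Dsin2 t) /X /Y /vx /vy; ring.
Qed.

Lemma vperp_dot_e_s t s : dot3 (vperp v (sph t s)) (e_s t s) = - comp_t t s.
Proof.
rewrite comp_tE -[Z t s]mulr1 -(cos2Dsin2 s) /vperp /cross3 /dot3 /X /Y /Z /sph /e_s /vx /vy /vz /=.
ring.
Qed.

(** In the derivative of [v x p] the term [v x dp] is orthogonal to [v], and the triple product with
    [dv] changes sign when two factors are swapped. The longitude derivative is treated in the same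
    way. *)
Lemma pd1_vperp_dot t s : 0 < t < pi ->
  dot3 (pd1 (inchart (vperp v)) t s) (v (sph t s)) =
  - dot3 (pd1 (inchart v) t s) (vperp v (sph t s)).
Proof.
move=> t0.
have [dX _ _ _] := sX (inch s t0); have [dY _ _ _] := sY (inch s t0).
have [dZ _ _ _] := sZ (inch s t0).
have dx : is_derive t 1 (fun a => sin a * cos s) (cos t * cos s).
  apply: (is_derive_eq (is_derive1M (is_derive_sin t) (is_derive_cst (cos s) t 1))).
  by rewrite mulr0 addr0.
have dy : is_derive t 1 (fun a => sin a * sin s) (cos t * sin s).
  apply: (is_derive_eq (is_derive1M (is_derive_sin t) (is_derive_cst (sin s) t 1))).
  by rewrite mulr0 addr0.
have dz := is_derive_cos t.
have Px := is_derive1_derive1 (is_derive1B (is_derive1M dY dz) (is_derive1M dZ dy)).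
have Py := is_derive1_derive1 (is_derive1B (is_derive1M dZ dx) (is_derive1M dX dz)).
have Pz := is_derive1_derive1 (is_derive1B (is_derive1M dX dy) (is_derive1M dY dx)).
rewrite /pd1 {1}/dot3 [vx (mk3 _ _ _)]Px [vy (mk3 _ _ _)]Py [vz (mk3 _ _ _)]Pz.
rewrite /dot3 /vperp /cross3 /inchart /vx /vy /vz /=; ring.
Qed.

Lemma pd2_vperp_dot t s : 0 < t < pi ->
  dot3 (pd2 (inchart (vperp v)) t s) (v (sph t s)) = - turn_speed t s.
Proof.
move=> t0.
have [_ dX _ _] := sX (inch s t0); have [_ dY _ _] := sY (inch s t0).
have [_ dZ _ _] := sZ (inch s t0).
have dx : is_derive s 1 (fun a => sin t * cos a) (- (sin t * sin s)).
  apply: (is_derive_eq (is_derive1M (is_derive_cst (sin t) s 1) (is_derive_cos s))).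
  by rewrite mul0r add0r mulrN.
have dy : is_derive s 1 (fun a => sin t * sin a) (sin t * cos s).
  apply: (is_derive_eq (is_derive1M (is_derive_cst (sin t) s 1) (is_derive_sin s))).
  by rewrite mul0r add0r.
have dz := is_derive_cst (cos t) s 1.
have Px := is_derive1_derive1 (is_derive1B (is_derive1M dY dz) (is_derive1M dZ dy)).
have Py := is_derive1_derive1 (is_derive1B (is_derive1M dZ dx) (is_derive1M dX dz)).
have Pz := is_derive1_derive1 (is_derive1B (is_derive1M dX dy) (is_derive1M dY dx)).
rewrite /pd2 {1}/dot3 [vx (mk3 _ _ _)]Px [vy (mk3 _ _ _)]Py [vz (mk3 _ _ _)]Pz.
rewrite /turn_speed /dot3 /vperp /cross3 /inchart /vx /vy /vz /=; ring.
Qed.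

(** Up to sign, [gam] and [del] are the values of one linear form on the orthonormal pair [v],
    [vperp v]. Their sum of squares is therefore that of its values on [e_t] and [e_s], and the
    [e_t] part is dropped. *)
Lemma vol_density_ge t s : 0 < t < pi ->
  Num.sqrt (sin t ^+ 2 + turn_speed t s ^+ 2) <=
  Num.sqrt (1 + gam v t s ^+ 2 + del v t s ^+ 2) * sin t.
Proof.
move=> t0; have st : 0 < sin t by exact: sin_gt0_pi.
rewrite /gam /del /dirder !dot3_lincomb vperp_dot_e_t vperp_dot_e_s.
rewrite pd1_vperp_dot// pd2_vperp_dot// -/(turn_speed t s).
rewrite -/(comp_t t s) -/(comp_s t s); set al := dot3 _ _.
rewrite -[X in _ * X]ger0_norm; last exact: ltW.
rewrite -sqrtr_sqr -sqrtrM; last by rewrite !addr_ge0// sqr_ge0.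
apply: ler_wsqrtr; rewrite -[leLHS]addr0.
set a := comp_t t s; set b := comp_s t s; set p := turn_speed t s.
have -> : (1 + (a * al + b / sin t * p) ^+ 2 + (b * - al + - a / sin t * - p) ^+ 2)
    * sin t ^+ 2 = sin t ^+ 2 + (a ^+ 2 + b ^+ 2) * (p ^+ 2 + (al * sin t) ^+ 2).
  by field; rewrite gt_eqF.
by rewrite comp_unit// mul1r addr0 addrA lerDl sqr_ge0.
Qed.

Lemma turn_speed_continuous t s : 0 < t < pi ->
  {for (t, s), continuous (fun w : R * R => turn_speed w.1 w.2)}.
Proof.
move=> t0.
have [_ _ cX cX2] := sX (inch s t0); have [_ _ cY cY2] := sY (inch s t0).
have [_ _ cZ cZ2] := sZ (inch s t0).
have [cc1 cs1 cc2 cs2] := trig_chart_continuous t s.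
by apply: cvgD; [apply: cvgD|]; (apply: cvgM; [assumption|]);
  apply: cvgB; repeat (apply: cvgM || assumption).
Qed.

Lemma comp_continuous t s : 0 < t < pi ->
  {for (t, s), continuous (fun w : R * R => comp_t w.1 w.2)} /\
  {for (t, s), continuous (fun w : R * R => comp_s w.1 w.2)}.
Proof.
move=> t0.
have [_ _ cX cX2] := sX (inch s t0); have [_ _ cY cY2] := sY (inch s t0).
have [_ _ cZ cZ2] := sZ (inch s t0).
have [cc1 cs1 cc2 cs2] := trig_chart_continuous t s.
split.
- rewrite (_ : (fun w => _) = fun w : R * R => X w.1 w.2 * (cos w.1 * cos w.2) +
    Y w.1 w.2 * (cos w.1 * sin w.2) - Z w.1 w.2 * sin w.1); last first.
    by apply/funext => w; exact: comp_tE.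
  by apply: cvgB; [apply: cvgD|]; repeat (apply: cvgM || assumption).
- rewrite (_ : (fun w => _) = fun w : R * R => Y w.1 w.2 * cos w.2 -
    X w.1 w.2 * sin w.2); last by apply/funext => w; exact: comp_sE.
  by apply: cvgB; repeat (apply: cvgM || assumption).
Qed.

Lemma comp_lift t : 0 < t < pi -> exists phi : R -> R, forall s, -1 < s ->
  [/\ is_derive s 1 phi (- turn_speed t s - cos t),
      comp_t t s = cos (phi s) & comp_s t s = sin (phi s)].
Proof.
move=> t0.
have c2 s : [/\ {for s, continuous (X t)}, {for s, continuous (Y t)},
    {for s, continuous (d2 X t)}, {for s, continuous (d2 Y t)} &
    {for s, continuous (d2 Z t)}].
  have [_ _ cX cX2] := sX (inch s t0); have [_ _ cY cY2] := sY (inch s t0).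
  have [_ _ cZ cZ2] := sZ (inch s t0).
  by split; exact: slice_continuous.
have [||||| phi lphi] := @unit_circle_lift R (comp_t t) (comp_s t) (comp_t' t) (comp_s' t).
- by move=> s; exact: is_derive_comp_t.
- by move=> s; exact: is_derive_comp_s.
- move=> s; have [? ? ? ? ?] := c2 s; have ? := @continuous_cos R s.
  have ? := @continuous_sin R s.
  by rewrite /comp_t'; repeat (assumption || exact: cvg_cst || apply: cvgB ||
    apply: cvgD || apply: cvgM).
- move=> s; have [? ? ? ? ?] := c2 s; have ? := @continuous_cos R s.
  have ? := @continuous_sin R s.
  by rewrite /comp_s'; repeat (assumption || exact: cvg_cst || apply: cvgB ||
    apply: cvgD || apply: cvgM).
- by move=> s; exact: comp_unit.
by exists phi => s /lphi[]; rewrite turn_speedE.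
Qed.

End ChartFrame.

(** * Turning numbers along parallels *)

Section Turning.
Variables (R : realType) (v : vec3 R -> vec3 R).
Hypothesis sv : smooth_unit_field v.
Implicit Types (t s u : R) (phi psi th : R -> R).

Definition is_angle_lift t phi := forall s, -1 < s ->
  [/\ is_derive s 1 phi (- turn_speed v t s - cos t),
      comp_t v t s = cos (phi s) & comp_s v t s = sin (phi s)].

Let pi2 : 0 < 2 * pi :> R. Proof. by have := pi_gt0 R; lra. Qed.

Lemma angle_lift_continuous t phi : is_angle_lift t phi ->
  {within `[0, 2 * pi]%classic, continuous phi}.
Proof.
move=> lphi; apply: derivable_within_continuous => s.
rewrite in_itv/= => /andP[s0 _].
by have [|[]] // := lphi s; rewrite (lt_le_trans _ s0) ?ltrN10.
Qed.

Lemma angle_lift_turn t phi : is_angle_lift t phi ->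
  exists n : int, phi (2 * pi) - phi 0 = 2 * pi * n%:~R.
Proof.
move=> lphi; have [_ c0 s0] := lphi 0 (ltrN10 R).
have [|_ c1 s1] := lphi (2 * pi); first by rewrite (lt_trans _ pi2) ?ltrN10.
have [ct cs] := comp_2pi v t.
by apply: eq_cos_sin; [rewrite -c0 -c1|rewrite -s0 -s1].
Qed.

(** The positive quantity is [cos (phi s - psi s)], so the difference of the two lifts cannot
    complete a turn. *)
Lemma angle_lift_compare t u phi psi :
  is_angle_lift t phi -> is_angle_lift u psi ->
  (forall s, 0 <= s <= 2 * pi ->
     0 < comp_t v t s * comp_t v u s + comp_s v t s * comp_s v u s) ->
  phi (2 * pi) - phi 0 = psi (2 * pi) - psi 0.
Proof.
move=> lphi lpsi pos.
have [n En] := angle_lift_turn lphi; have [p Ep] := angle_lift_turn lpsi.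
suff : n - p = 0 by move/eqP; rewrite subr_eq0 => /eqP np; rewrite En Ep np.
apply: (@cos_gt0_no_turn R (fun s => phi s - psi s) (2 * pi)); first exact: ltW.
- move=> s; apply: cvgB; [exact: (angle_lift_continuous lphi)|
    exact: (angle_lift_continuous lpsi)].
- move=> s s2; have s1 : -1 < s by case/andP: s2 => s0 _; rewrite (lt_le_trans _ s0) ?ltrN10.
  have := pos s s2; have [_ -> ->] := lphi s s1; have [_ -> ->] := lpsi s s1.
  by rewrite cosB.
- by rewrite intrB mulrBr -En -Ep; lra.
Qed.

(* Nearby parallels carry nearby curves on the unit circle, uniformly in the
   longitude by compactness, so the turning number cannot jump. *)
Lemma angle_lift_const t u phi psi : 0 < t < pi -> 0 < u < pi ->
  is_angle_lift t phi -> is_angle_lift u psi ->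
  phi (2 * pi) - phi 0 = psi (2 * pi) - psi 0.
Proof.
move=> t0 u0 lphi lpsi.
have ex (r : R) : exists f : R -> R, 0 < r < pi -> is_angle_lift r f.
  (* Outside []0, pi[] any function will do; [id] only makes the choice total. *)
  have [r0|_] := boolP (0 < r < pi); last by exists id.
  by have [f lf] := comp_lift sv r0; exists f.
have [F lF] := choice ex.
(* A curve compared with itself has inner product 1, so the turning number does not depend on the
   lift. *)
have same r f : 0 < r < pi -> is_angle_lift r f ->
    f (2 * pi) - f 0 = F r (2 * pi) - F r 0.
  move=> r0 lf; apply: (angle_lift_compare lf (lF r r0)) => s _.
  by rewrite -!expr2 comp_unit.
rewrite (same _ _ t0 lphi) (same _ _ u0 lpsi).
apply: (@locally_cst_itv R (fun r => F r (2 * pi) - F r 0) 0 pi) => // r r0.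
have near_pos : \forall u \near r, `[0, 2 * pi]%classic `<=` (fun s =>
    0 < comp_t v u s * comp_t v r s + comp_s v u s * comp_s v r s).
  have /compact_near_coveringP cov := @segment_compact R 0 (2 * pi).
  apply: (cov R (nbhs r) (fun u s =>
    0 < comp_t v u s * comp_t v r s + comp_s v u s * comp_s v r s)) => s _.
  have swap (f : R -> R -> R) : {for (r, s), continuous (fun w : R * R => f w.1 w.2)} ->
      {for (s, r), continuous (fun w : R * R => f w.2 w.1)}.
    move=> cf; apply: (@continuous_comp _ _ _ (fun w : R * R => (w.2, w.1))
      (fun w : R * R => f w.1 w.2)); last exact: cf.
    by apply: (@cvg_pair _ _ _ (nbhs (s, r)) (nbhs r) (nbhs s));
      [exact: cvg_snd|exact: cvg_fst].
  have [ct cs] := comp_continuous sv s r0.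
  have cs2 f : {for (r, s), continuous (fun w : R * R => f w.1 w.2)} ->
      {for (s, r), continuous (fun w : R * R => f r w.1 : R)}.
    move=> cf; apply: (@continuous_comp _ _ _ fst (f r)); first exact: cvg_fst.
    exact: slice_continuous.
  have cG : {for (s, r), continuous (fun w : R * R =>
      comp_t v w.2 w.1 * comp_t v r w.1 + comp_s v w.2 w.1 * comp_s v r w.1)}.
    by apply: cvgD; apply: cvgM; [exact: swap|exact: cs2|exact: swap|exact: cs2].
  have := cG [set x | 0 < x]; apply.
  by rewrite /= -!expr2 comp_unit//; exact: (@lt_nbhsr R 0 1 ltr01).
have near_itv : \forall x \near r, 0 < x < pi.
  case/andP: r0 => r1 r2; near=> x.
  by apply/andP; split; near: x; [exact: lt_nbhsr r1|exact: lt_nbhsl r2].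
near=> x; have x0 : 0 < x < pi by near: x.
apply: (angle_lift_compare (lF x x0) (lF r r0)) => s s2.
have : `[0, 2 * pi]%classic `<=` (fun s =>
    0 < comp_t v x s * comp_t v r s + comp_s v x s * comp_s v r s) by near: x.
by apply; rewrite /= in_itv.
Unshelve. all: by end_near. Qed.

(** Near the north pole [e_t] projects outwards, so the projected field stays within a quarter turn
    of the direction [s + phi s]. The term [s] accounts for one turn, which is subtracted from the
    index. *)
Lemma index_N_turn (n : int) : index_N v n ->
  exists t phi, [/\ 0 < t < pi, is_angle_lift t phi &
    phi (2 * pi) - phi 0 = 2 * pi * (n - 1)%:~R].
Proof.
move=> [e0 [e00 wn]]; have pi0 := pi_gt0 R.
(* Below [pi / 2] the cosine is positive; halving makes both bounds strict. *)
pose t := Num.min e0 (pi / 2) / 2.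
have t1 : 0 < t by rewrite divr_gt0// lt_min e00 divr_gt0.
have t2 : t < e0.
  by rewrite /t ltr_pdivrMr// (le_lt_trans (_ : _ <= e0)) ?ge_min ?lexx//; lra.
have t3 : t < pi / 2.
  by rewrite /t ltr_pdivrMr// (le_lt_trans (_ : _ <= pi / 2)) ?ge_min ?lexx ?orbT//; lra.
have t0 : 0 < t < pi by lra.
have ct : 0 < cos t by apply: cos_gt0_pihalf; lra.
have [phi lphi] := comp_lift sv t0.
have [|th [r [cth [rth dth]]]] := wn t; first by rewrite t1.
exists t, phi; split => //; have [j Ej] := angle_lift_turn lphi.
suff : n - 1 - j = 0 by move/eqP; rewrite subr_eq0 => /eqP ->.
apply: (@cos_gt0_no_turn R (fun s => th s - (s + phi s)) (2 * pi)); first exact: ltW.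
- move=> s; apply: cvgB; first exact: cth.
  apply: cvgD; last exact: (angle_lift_continuous lphi).
  by apply: continuous_subspaceT => x; exact: cvg_id.
- move=> s s2; have s1 : -1 < s by case/andP: s2 => s0 _; rewrite (lt_le_trans _ s0) ?ltrN10.
  have [r0 [xE yE]] := rth s s2; have [_ aE bE] := lphi s s1.
  rewrite -(pmulr_rgt0 _ r0) cosB cosD sinD -aE -bE.
  have cr := comp_radial sv s t0; have cu := comp_unit sv s t0.
  have bs := comp_sE v t s; rewrite /= in cr bs.
  set a := comp_t v t s in aE cr cu *; set b := comp_s v t s in bE bs cu *.
  rewrite mulrDr !mulrA -xE -yE.
  have -> : vx (v (sph t s)) * (cos s * a - sin s * b) +
      vy (v (sph t s)) * (sin s * a + cos s * b) =
      a * (vx (v (sph t s)) * cos s + vy (v (sph t s)) * sin s) +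
      b * (vy (v (sph t s)) * cos s - vx (v (sph t s)) * sin s) by ring.
  (* What remains is [cos t * a ^+ 2 + b ^+ 2], positive because [a] and [b] are not both zero. *)
  rewrite cr -bs.
  have := sqr_ge0 a; have := sqr_ge0 b; nra.
- by rewrite !intrB !mulrBr -Ej; lra.
Qed.

(** Near the south pole [e_t] projects inwards, which reverses orientation: the projected field
    stays within a quarter turn of the direction [s - phi s + pi], and [phi] enters the index with a
    minus sign. *)
Lemma index_S_turn (n : int) : index_S v n ->
  exists t phi, [/\ 0 < t < pi, is_angle_lift t phi &
    phi (2 * pi) - phi 0 = 2 * pi * (1 - n)%:~R].
Proof.
move=> [e0 [e00 wn]]; have pi0 := pi_gt0 R.
pose e := Num.min e0 (pi / 2) / 2; pose t := pi - e.
have t1 : 0 < e by rewrite divr_gt0// lt_min e00 divr_gt0.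
have t2 : e < e0.
  by rewrite /e ltr_pdivrMr// (le_lt_trans (_ : _ <= e0)) ?ge_min ?lexx//; lra.
have t3 : e < pi / 2.
  by rewrite /e ltr_pdivrMr// (le_lt_trans (_ : _ <= pi / 2)) ?ge_min ?lexx ?orbT//; lra.
have t0 : 0 < t < pi by rewrite /t; lra.
have ct : cos t < 0.
  have : 0 < cos e by apply: cos_gt0_pihalf; lra.
  by rewrite /t cosB cospi sinpi; lra.
have [phi lphi] := comp_lift sv t0.
have [|th [r [cth [rth dth]]]] := wn e; first by rewrite t1.
exists t, phi; split => //; have [j Ej] := angle_lift_turn lphi.
suff : n - 1 + j = 0.
  by move/eqP; rewrite addr_eq0 => /eqP nj; rewrite Ej -(opprK j) -nj opprB.
apply: (@cos_gt0_no_turn R (fun s => th s - (s - phi s) + pi) (2 * pi)); first exact: ltW.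
- move=> s; apply: cvgD; last exact: cvg_cst.
  apply: cvgB; first exact: cth.
  apply: cvgB; last exact: (angle_lift_continuous lphi).
  by apply: continuous_subspaceT => x; exact: cvg_id.
- move=> s s2; have s1 : -1 < s by case/andP: s2 => s0 _; rewrite (lt_le_trans _ s0) ?ltrN10.
  have [r0 [xE yE]] := rth s s2; have [_ aE bE] := lphi s s1.
  rewrite -(pmulr_rgt0 _ r0) cosDpi cosB [cos (s - _)]cosB [sin (s - _)]sinB -aE -bE.
  have cr := comp_radial sv s t0; have cu := comp_unit sv s t0.
  have bs := comp_sE v t s; rewrite /= in cr bs.
  set a := comp_t v t s in aE cr cu *; set b := comp_s v t s in bE bs cu *.
  rewrite mulrN mulrDr !mulrA -xE -yE -/t.
  have -> : vx (v (sph t s)) * (cos s * a + sin s * b) +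
      vy (v (sph t s)) * (sin s * a - cos s * b) =
      a * (vx (v (sph t s)) * cos s + vy (v (sph t s)) * sin s) -
      b * (vy (v (sph t s)) * cos s - vx (v (sph t s)) * sin s) by ring.
  rewrite cr -bs.
  have := sqr_ge0 a; have := sqr_ge0 b; nra.
- by rewrite intrD intrB; lra.
Qed.

End Turning.

(** * The bound on one parallel and its integration over the colatitude *)

(* The integrand is bounded below by its linearisation in the direction of
   [(sin t, m + cos t)], whose integral only sees the turning number; this is the
   equality case of Jensen's inequality made explicit. *)
Lemma parallel_bound (R : realType) (v : vec3 R -> vec3 R) (t m : R) (phi : R -> R) :
  smooth_unit_field v -> 0 < t < pi -> is_angle_lift v t phi ->
  phi (2 * pi) - phi 0 = 2 * pi * m -> 0 < 1 + m ^+ 2 + 2 * m * cos t ->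
  ((2 * pi * Num.sqrt (1 + m ^+ 2 + 2 * m * cos t))%:E <=
   \int[lebesgue_measure]_(s in `]0%R, (2 * pi)%R[)
     (Num.sqrt (sin t ^+ 2 + turn_speed v t s ^+ 2))%:E)%E.
Proof.
move=> sv t0 lphi dphi h0; have pi0 := pi_gt0 R.
set h := Num.sqrt _; have hp : 0 < h by rewrite sqrtr_gt0.
have hE : h ^+ 2 = sin t ^+ 2 + (m + cos t) ^+ 2.
  rewrite sqr_sqrtr ?ltW// sqrrD.
  have -> : 1 + m ^+ 2 + 2 * m * cos t = cos t ^+ 2 + sin t ^+ 2 + m ^+ 2 + 2 * m * cos t.
    by rewrite cos2Dsin2.
  by ring.
have cT : continuous (turn_speed v t).
  by move=> s; apply: slice_continuous; exact: turn_speed_continuous.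
pose g s := (sin t ^+ 2 - turn_speed v t s * (m + cos t)) / h.
pose G s := Num.sqrt (sin t ^+ 2 + turn_speed v t s ^+ 2).
have cg : continuous g.
  move=> s; apply: cvgM; last exact: cvg_cst.
  by apply: cvgB; [exact: cvg_cst|apply: cvgM; [exact: cT|exact: cvg_cst]].
have cG : continuous G.
  move=> s; apply: (@continuous_comp _ _ _ (fun s => sin t ^+ 2 + turn_speed v t s ^+ 2)
    Num.sqrt); last exact: sqrt_continuous.
  by apply: cvgD; [exact: cvg_cst|apply: cvgM; exact: cT].
have gG s : g s <= G s.
  rewrite /g ler_pdivrMr//; apply: (le_trans (ler_norm _)).
  rewrite -sqrtr_sqr -sqrtrM; last by rewrite addr_ge0 ?sqr_ge0.
  apply: ler_wsqrtr; rewrite -[X in _ <= _ * X]sqr_sqrtr ?(ltW h0)// -/h hE.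
  (* Cauchy-Schwarz for [(sin t, - turn_speed v t s)] and [(sin t, m + cos t)], with Lagrange's
     identity giving the defect as a square. *)
  rewrite -subr_ge0.
  rewrite (_ : _ - _ = (sin t * (m + cos t) + turn_speed v t s * sin t) ^+ 2) ?sqr_ge0//.
  ring.
have pi2 : 0 < 2 * pi :> R by lra.
(* Since [- turn_speed] is the derivative of [phi s + cos t * s], the linearisation has an explicit
   primitive. *)
pose P s := (sin t ^+ 2 * s + (phi s + cos t * s) * (m + cos t)) / h.
have dP s : 0 <= s <= 2 * pi -> is_derive s 1 P (g s).
  move=> /andP[s0 _]; have [|dph _ _] := lphi s; first by rewrite (lt_le_trans _ s0) ?ltrN10.
  have ds (c : R) : is_derive s 1 (fun s => c * s) c.
    apply: (is_derive_eq (is_derive1M (is_derive_cst c s 1) (is_derive_id s 1))).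
    by rewrite mul0r add0r mulr1.
  apply: (is_derive_eq (is_derive1M (is_derive1D (ds (sin t ^+ 2))
    (is_derive1M (is_derive1D dph (ds (cos t))) (is_derive_cst (m + cos t) s 1)))
    (is_derive_cst h^-1 s 1))).
  by rewrite /g /cst; ring.
have gI : (2 * pi * h)%:E = (\int[lebesgue_measure]_(s in `[0%R, (2 * pi)%R]) (g s)%:E)%E.
  rewrite (FTC2_continuous pi2 cg dP) /P; congr EFin.
  rewrite -mulrBl.
  have -> : sin t ^+ 2 * (2 * pi) + (phi (2 * pi) + cos t * (2 * pi)) * (m + cos t) -
      (sin t ^+ 2 * 0 + (phi 0 + cos t * 0) * (m + cos t)) = 2 * pi * h ^+ 2.
    rewrite hE (_ : phi (2 * pi) = phi 0 + 2 * pi * m); last by lra.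
    by ring.
  by field; rewrite gt_eqF.
rewrite gI -(@integral_itv_bndoo R 0 (2 * pi) (EFin \o G) true false); last first.
  by apply/measurable_EFinP; apply: measurable_funTS; exact: continuous_measurable_fun.
apply: le_integral => //; last by move=> s _; rewrite lee_fin.
- by apply: continuous_compact_integrable; [exact: segment_compact|exact: continuous_subspaceT].
- by apply: continuous_compact_integrable; [exact: segment_compact|exact: continuous_subspaceT].
Qed.

Theorem theorem1 (R : realType) (v : vec3 R -> vec3 R) (iN iS k : int) :
  smooth_unit_field v ->
  index_N v iN -> index_S v iS ->
  k = Order.max iN iS -> (2 < k)%R ->
  ((pi%:E * ellipse_length (k%:~R : R)) <= vol v)%E.
Proof.
move=> sv hN hS kE k2.
(* The turning number is read at a pole of maximal index: [iN - 1] at the north, [1 - iS] at the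
   south. [angle_lift_const] carries it to every other parallel. *)
have [j [t [phi [jE t0 lphi dphi]]]] : exists (j : int) (t : R) (phi : R -> R),
    [/\ j = k - 1 \/ j = 1 - k, 0 < t < pi, is_angle_lift v t phi &
        phi (2 * pi) - phi 0 = 2 * pi * j%:~R].
  have [le|le] := leP iS iN.
  - have [t [phi [t0 lphi dphi]]] := index_N_turn sv hN.
    by exists (iN - 1), t, phi; split => //; left; rewrite kE max_l.
  - have [t [phi [t0 lphi dphi]]] := index_S_turn sv hS.
    by exists (1 - iS), t, phi; split => //; right; rewrite kE max_r// ltW.
have kR : 2 < k%:~R :> R by rewrite (_ : 2 = 2%:~R)// ltr_int.
pose m : R := j%:~R.
have mE : m = k%:~R - 1 \/ m = 1 - k%:~R.
  by case: jE => jE; [left|right]; rewrite /m jE intrB.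
rewrite (pi_ellipse_lengthE mE).
pose G (z : R * R) := Num.sqrt (sin z.1 ^+ 2 + turn_speed v z.1 z.2 ^+ 2).
have GV : (\int[(@lebesgue_measure R \x @lebesgue_measure R)%E]_(z in @vol_dom R)
    (G z)%:E <= vol v)%E.
  apply: ge0_le_integral_nonmeas => -[x y] /= [].
    by rewrite lee_fin sqrtr_ge0.
  by rewrite /= in_itv/= => x0 _; rewrite lee_fin; exact: vol_density_ge.
apply: le_trans GV.
have pi0 := pi_gt0 R.
apply: le_integral_rectangle.
- move=> [x y] /= x0; apply: (@continuous_comp _ _ _
    (fun z : R * R => sin z.1 ^+ 2 + turn_speed v z.1 z.2 ^+ 2) Num.sqrt);
    last exact: sqrt_continuous.
  have ct := turn_speed_continuous sv (s := y) x0.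
  have cs : {for (x, y), continuous (fun z : R * R => sin z.1)}.
    by apply: (@continuous_comp _ _ _ fst (@sin R)); [exact: cvg_fst|exact: continuous_sin].
  by apply: cvgD; apply: cvgM.
- by move=> z; exact: sqrtr_ge0.
- by move=> x; rewrite mulr_ge0 ?sqrtr_ge0//; lra.
- move=> x x0; have [psi lpsi] := comp_lift sv x0.
  apply: (parallel_bound sv x0 lpsi).
    by rewrite -(angle_lift_const sv t0 x0 lphi lpsi).
  (* As [2 < k], the absolute value of [m] exceeds 1, so the radicand is at least
     [(k - 1 - 1) ^+ 2 > 0]. *)
  have := cos_le1 x; have := cos_geN1 x; case: mE => ->; nra.
Qed.
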